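(* Let $f(x)=x^r g(x)$ where $r\ge1$ and $g(x)\in\mathbb{Z}[x]$ is nonconstant with $g(0)\neq0$. Let $x_0\in\mathbb{Z}$ have a wandering orbit $(x_n)_{n\ge0}$ under $x\mapsto f(x)$, and define \[ a_{n+1}=\frac{g(x_n)}{\gcd(g(x_n),g(0))}\quad\text{for all } n\ge0. \] Then $(a_n)_{n\ge1}$ is an infinite sequence of pairwise coprime integers, and for all sufficiently large $n$, $a_n$ has a private prime factor.
   Context: $f^n$ denotes the $n$-fold composition of $f$; the orbit of $x_0$ is $x_n=f^n(x_0)$. The orbit is wandering if the $x_n$, $n\ge0$, are pairwise distinct. For a sequence of integers $(a_n)$, a prime $p$ is a private prime factor of $a_n$ if $p$ divides $a_n$ and no other term $a_m$, $m\ne n$. *)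

(* Defs.v *)
From HB Require Import structures.
From mathcomp Require Import all_boot all_order all_algebra.

Set Implicit Arguments.
Unset Strict Implicit.
Unset Printing Implicit Defensive.

Import Order.TTheory GRing.Theory Num.Theory.
Local Open Scope ring_scope.

Definition orbit_seq (T : Type) (f : T -> T) (x0 : T) (n : nat) : T :=
  iter n f x0.

Definition wandering (T : Type) (f : T -> T) (x0 : T) : Prop :=
  forall m n : nat, m <> n -> orbit_seq f x0 m <> orbit_seq f x0 n.

(* In the next two definitions the sequence is (a_n)_{n >= n0}: the values of
   a at indices below n0 are not terms of the sequence. *)
Definition pairwise_coprime_from (n0 : nat) (a : nat -> int) : Prop :=
  forall m n : nat, (n0 <= m)%N -> (n0 <= n)%N -> m <> n ->
    coprimez (a m) (a n).

Definition private_prime_factor_from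
    (n0 : nat) (a : nat -> int) (n p : nat) : Prop :=
  [/\ (n0 <= n)%N, prime p, (p%:Z %| a n)%Z
    & forall m : nat, (n0 <= m)%N -> m <> n -> ~~ (p%:Z %| a m)%Z].

(* Main.v *)
(** If [i < j] then [g(x_i)] divides [x_(i+1)], hence [x_j], because [f(0) = 0].
    Put [d = gcd(g(x_i), g(0))], [g(x_i) = a d] and [g(0) = b d] with [a], [b]
    coprime.  As [a d] divides [x_j], one gets [g(x_j) = d (b + a k)], so
    [g(x_j) / gcd(g(x_j), g(0))] divides [b + a k], which is coprime to [a].
    Since [g] takes each value finitely often on a wandering orbit, eventually
    [|g(x_n)| > |g(0)|], so [a_(n+1)] is not a unit, and by coprimality any of
    its prime factors is private. *)
Require Import Defs.
From HB Require Import structures.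
From mathcomp Require Import all_boot all_order all_algebra.
From mathcomp Require Import ring zify.
From Stdlib Require Import Classical.

Set Implicit Arguments.
Unset Strict Implicit.
Unset Printing Implicit Defensive.

Import Order.TTheory GRing.Theory Num.Theory.
Local Open Scope ring_scope.

Lemma dvdz_horner_sub (p : {poly int}) (x y : int) :
  (x - y %| p.[x] - p.[y])%Z.
Proof.
have /factor_theorem [q Hq] : root (p - p.[y]%:P) y by rewrite /root !hornerE subrr.
have -> : p.[x] - p.[y] = (p - p.[y]%:P).[x] by rewrite !hornerE.
by rewrite Hq hornerM hornerXsubC dvdz_mull.
Qed.

Lemma dvdz_horner_fixed0 (p : {poly int}) (x : int) :
  p.[0] = 0 -> (x %| p.[x])%Z.
Proof. by move=> p0; have := dvdz_horner_sub p x 0; rewrite p0 !subr0. Qed.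

Lemma dvdz_iter (h : int -> int) (x : int) (m n : nat) :
  (forall y, (y %| h y)%Z) -> (m <= n)%N -> (iter m h x %| iter n h x)%Z.
Proof.
move=> hdvd /subnK <-; elim: (n - m)%N => [|k IHk] //.
exact: dvdz_trans IHk (hdvd _).
Qed.

(** Used with [u], [v], [c] equal to g(x_i), g(x_j), g(0) for i < j. *)
Lemma coprimez_div_gcdz (u v c : int) :
  c != 0 -> (u %| v - c)%Z ->
  coprimez (u %/ gcdz u c)%Z (v %/ gcdz v c)%Z.
Proof.
move=> c0 /dvdzP[k vE].
have d0 : gcdz u c != 0 by rewrite gcdz_eq0 (negbTE c0) andbF.
have [/dvdzP[a0 uE] /dvdzP[b cE]] := (dvdz_gcdl u c, dvdz_gcdr u c).
move: d0 uE cE; set d := gcdz u c => d0 uE cE.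
have cop : coprimez a0 b.
  rewrite /coprimez; apply/eqP; apply: (mulIf d0).
  (* A gcd is nonnegative, so [d] is the absolute value that [mulz_gcdl] asks for. *)
  have <- : `|d|%:Z = d by [].
  by rewrite mulz_gcdl -uE -cE mul1r.
rewrite uE mulzK //.
have vE' : v = (b + k * a0) * d by rewrite -[v](subrK c) vE cE uE; ring.
have wdvd : ((v %/ gcdz v c)%Z %| b + k * a0)%Z.
  have e0 : gcdz v c != 0 by rewrite gcdz_eq0 (negbTE c0) andbF.
  (* [d] divides both [v] and [c], hence their gcd; the cofactor [t] is the quotient witness
     below. *)
  have [t tE] : exists t, gcdz v c = t * d.
    by apply/dvdzP; rewrite dvdz_gcd vE' cE !dvdz_mull.
  have /dvdzP[w wE] := dvdz_gcdl v c.
  rewrite {1}wE mulzK //; apply/dvdzP; exists t; apply: (mulIf d0).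
  by rewrite -vE' {1}wE tE; ring.
suff : coprimez a0 (b + k * a0) by apply: coprimez_dvdr.
by rewrite /coprimez addrC gcdzMDl.
Qed.

(** Induction on the size: a root [u n0] splits off a linear factor, which by injectivity vanishes
    at no later index. *)
Lemma eventually_not_root (R : idomainType) (u : nat -> R) (p : {poly R}) :
  injective u -> p != 0 ->
  exists N : nat, forall n : nat, (N <= n)%N -> ~~ root p (u n).
Proof.
move=> uI; have [s] := ubnP (size p); elim: s p => // s IHs p ltps p0.
have [[n0 rn0]|nroot] := classic (exists n, root p (u n)); last first.
  by exists 0%N => n _; apply/negP => rn; apply: nroot; exists n.
have /factor_theorem [q pE] := rn0.
have q0 : q != 0 by apply: contraNneq p0 => q0; rewrite pE q0 mul0r.
have [|N HN] := IHs q _ q0.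
  by move: ltps; rewrite pE size_Mmonic ?monicXsubC // size_XsubC addn2.
exists (maxn N n0.+1) => n; rewrite geq_max => /andP[/HN qn lt_n0n].
rewrite pE rootM (negbTE qn) root_XsubC /=.
by apply: contraTneq lt_n0n => /uI ->; rewrite ltnn.
Qed.

Lemma eventually_lt_abs_horner (p : {poly int}) (u : nat -> int) (B : nat) :
  injective u -> (1 < size p)%N ->
  exists N : nat, forall n : nat, (N <= n)%N -> (B < `|p.[u n]|)%N.
Proof.
move=> uI sp.
have neqC (c : int) : exists N, forall n, (N <= n)%N -> p.[u n] != c.
  have pc0 : p - c%:P != 0.
    by apply: contraTneq sp => /subr0_eq ->; rewrite -leqNgt size_polyC leq_b1.
  have [N HN] := eventually_not_root uI pc0; exists N => n /HN.
  by rewrite /root !hornerE subr_eq0.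
elim: B => [|B [N HN]].
  by have [N HN] := neqC 0; exists N => n /HN; rewrite absz_gt0.
(* Above [B], only the two values of absolute value [B.+1] remain to be avoided. *)
have [N1 HN1] := neqC B.+1%:Z; have [N2 HN2] := neqC (- B.+1%:Z).
exists (maxn N (maxn N1 N2)) => n; rewrite !geq_max => /and3P[/HN + /HN1 + /HN2].
lia.
Qed.

Theorem theorem5 (r : nat) (g f : {poly int}) (x0 : int) (a : nat -> int)
    (hr : (1 <= r)%N)
    (hg : (1 < size g)%N)
    (hg0 : g.[0] != 0)
    (hf : f = 'X^r * g)
    (hx0 : wandering (fun x : int => f.[x]) x0)
    (ha : forall n : nat,
       let gx := g.[orbit_seq (fun x : int => f.[x]) x0 n] in
       a n.+1 = (gx %/ gcdz gx g.[0])%Z) :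
  pairwise_coprime_from 1 a /\
  (exists N : nat, forall n : nat, (N <= n)%N ->
     exists p : nat, private_prime_factor_from 1 a n p).
Proof.
set x := orbit_seq (fun x : int => f.[x]) x0 in hx0 ha.
have xI : injective x.
  by move=> m n xmn; apply/eqP; apply: contraPT xmn => /eqP /hx0.
have f0 : f.[0] = 0 by rewrite hf hornerM hornerXn expr0n eqn0Ngt hr mul0r.
have cop_lt i j : (i < j)%N -> coprimez (a i.+1) (a j.+1).
  move=> ltij; rewrite !ha; apply: coprimez_div_gcdz => //.
  have gx : (g.[x i] %| x i.+1)%Z.
    have -> : x i.+1 = ('X^r * g).[x i] by rewrite -hf.
    by rewrite hornerM dvdz_mull.
  (* The chain is g(x_i) | x_(i+1) | x_j | g(x_j) - g(0). *)
  apply: dvdz_trans gx (dvdz_trans (n := x j) _ _).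
    by apply: dvdz_iter => // y; apply: dvdz_horner_fixed0.
  by have := dvdz_horner_sub g (x j) 0; rewrite subr0.
have cop : pairwise_coprime_from 1 a.
  move=> [|i] [|j] // _ _ neq_ij; have : i <> j by congruence.
  case: (ltngtP i j) => // [ltij|ltji] _; first exact: cop_lt.
  by rewrite coprimez_sym; apply: cop_lt.
split=> //.
have [N HN] := eventually_lt_abs_horner `|g.[0]| xI hg.
(* The bound shifts by one because [a n.+1] is built from [x n]. *)
exists N.+1 => -[//|n] /HN lt_g0.
(* Otherwise g(x_n) equals its gcd with g(0) up to sign, so it divides the nonzero g(0) and cannot
   exceed it in size. *)
have a1 : `|a n.+1|%N != 1%N.
  apply: contraTneq lt_g0 => a1; rewrite -leqNgt.
  have /divzK <- := dvdz_gcdl g.[x n] g.[0].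
  rewrite -ha abszM a1 mul1n dvdn_leq ?absz_gt0 //.
  exact: (dvdz_gcdr g.[x n] g.[0]).
(* Zero must be excluded too: [pdiv] is prime only above 1. *)
have a0 : (0 < `|a n.+1|)%N.
  rewrite absz_gt0; apply: contraTneq lt_g0 => a0; rewrite -leqNgt.
  have /divzK <- := dvdz_gcdl g.[x n] g.[0].
  by rewrite -ha a0 mul0r.
have p_pr : prime (pdiv `|a n.+1|) by rewrite pdiv_prime // ltn_neqAle eq_sym a1.
exists (pdiv `|a n.+1|); split=> //; first by rewrite dvdzE /= pdiv_dvd.
move=> m m1 neq_mn; apply/negP => pm.
have /eqP co := cop _ _ m1 (ltn0Sn n) neq_mn.
have : (pdiv `|a n.+1|%N %| gcdz (a m) (a n.+1))%Z.
  by rewrite dvdz_gcd pm dvdzE /= pdiv_dvd.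
by rewrite co dvdzE /= dvdn1 => /eqP p1; rewrite p1 in p_pr.
Qed.
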